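(* For $n\ge 1$ let $F_n$ be the friendship graph. In the Strings-and-Coins game on $F_n$ with optimal play: if $n$ is odd, Player 2 wins by exactly three points; if $n$ is even, Player 1 wins by exactly one point.
   Context: Strings-and-Coins game: played on a finite multigraph (loops and parallel edges allowed) in which every vertex initially has at least one incident edge. Two players, Player 1 moving first, alternately remove one edge. Whenever a removal leaves one or more vertices with no incident edges, the mover earns one point for each such vertex and must move again, provided edges remain. The game ends when no edges remain; a player wins if they have more points, and it is a tie if scores are equal. Optimal play means each player maximizes (own final score) minus (opponent's final score). ''Player X wins by $m$ points'' means that under optimal play the final score of X exceeds the opponent's by exactly $m$. The friendship graph $F_n$ consists of $n$ copies of the triangle $K_3$ that share a single common vertex and are otherwise disjoint (so it has $2n+1$ vertices and $3n$ edges). *)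

(* Defs.v *)
From HB Require Import structures.
From mathcomp Require Import all_boot all_order all_algebra.

Set Implicit Arguments.
Unset Strict Implicit.
Unset Printing Implicit Defensive.

Import Order.TTheory GRing.Theory Num.Theory.

(* Edges have their own identity, so parallel edges are allowed; a loop at v
   has endpoints (v, v). *)
Record multigraph := Multigraph {
  vertex : finType;
  edge : finType;
  ends : edge -> vertex * vertex }.

Definition incident (G : multigraph) (e : edge G) (v : vertex G) : bool :=
  (v == (ends e).1) || (v == (ends e).2).

Definition isolated (G : multigraph) (A : {set edge G}) (v : vertex G) : bool :=
  [forall e in A, ~~ incident e v].

(* The game is played on multigraphs satisfying this predicate. *)
Definition no_isolated (G : multigraph) : bool :=
  [forall v : vertex G, ~~ isolated [set: edge G] v].

Inductive player := Player1 | Player2.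

Definition opponent (X : player) : player :=
  if X is Player1 then Player2 else Player1.

Record position (G : multigraph) := Position {
  edges_left : {set edge G};
  to_move : player;
  score1 : nat;
  score2 : nat }.

Definition start (G : multigraph) : position G :=
  Position [set: edge G] Player1 0 0.

Definition gain (G : multigraph) (A : {set edge G}) (e : edge G) : nat :=
  #|[set v | ~~ isolated A v & isolated (A :\ e) v]|.

Definition remove (G : multigraph) (p : position G) (e : edge G) : position G :=
  let: Position A X s1 s2 := p in
  let g := gain A e in
  Position (A :\ e)
    (if (0 < g)%N then X else opponent X)
    (if X is Player1 then s1 + g else s1)
    (if X is Player2 then s2 + g else s2).

Local Open Scope ring_scope.

Definition score_diff (G : multigraph) (p : position G) : int :=
  (score1 p)%:Z - (score2 p)%:Z.

(* Meaningful only if s is nonempty; the seed head 0 s is then in s. *)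
Definition maxseq (s : seq int) : int := \big[Num.max/head 0 s]_(x <- s) x.
Definition minseq (s : seq int) : int := \big[Num.min/head 0 s]_(x <- s) x.

(* Backward induction on the number k of edges left: final score of Player 1
   minus final score of Player 2 when, at every position, Player 1 moves so as
   to maximize this quantity and Player 2 moves so as to maximize its
   opposite. *)
Fixpoint optimal_rec (G : multigraph) (k : nat) (p : position G) : int :=
  if k is k'.+1 then
    let outcomes :=
      [seq optimal_rec k' (remove p e) | e <- enum (edges_left p)] in
    if to_move p is Player1 then maxseq outcomes else minseq outcomes
  else score_diff p.

Definition optimal_diff (G : multigraph) (p : position G) : int :=
  optimal_rec #|edges_left p| p.

Definition wins_by (G : multigraph) (X : player) (m : nat) : Prop :=
  (if X is Player1 then optimal_diff (start G) else - optimal_diff (start G))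
    = m%:Z.

(* The common vertex is None, and Some (i, false), Some (i, true) are the two
   other vertices of the i-th triangle.  The edge (i, Some b) joins the common
   vertex to Some (i, b); the edge (i, None) is the third side. *)
Definition friendship_ends (n : nat) (e : 'I_n * option bool) :
    option ('I_n * bool) * option ('I_n * bool) :=
  match e with
  | (i, Some b) => (None, Some (i, b))
  | (i, None) => (Some (i, false), Some (i, true))
  end.

Definition friendship (n : nat) : multigraph :=
  Multigraph (@friendship_ends n).

Lemma card_friendship_vertex (n : nat) : #|vertex (friendship n)| = n.*2.+1.
Proof. by rewrite card_option card_prod card_ord card_bool muln2. Qed.

Lemma card_friendship_edge (n : nat) : #|edge (friendship n)| = (3 * n)%N.
Proof. by rewrite card_prod card_ord card_option card_bool mulnC. Qed.

Lemma friendship_no_isolated (n : nat) : (0 < n)%N -> no_isolated (friendship n).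
Proof.
move=> n0; apply/forallP => v; rewrite negb_forall; apply/existsP.
case: v => [[i b]|].
  exists ((i, Some b) : edge (friendship n)).
  by rewrite in_setT /incident /= ?eqxx ?orbT.
exists ((Ordinal n0, Some true) : edge (friendship n)).
by rewrite in_setT.
Qed.

(* Main.v *)
(* Up to symmetry a position of the game on the friendship graph is given by
   four counts: t intact triangles, p paths (one spoke with the outer side), s
   bare spokes and b detached outer sides.  Detached sides and bare spokes are
   free points; a path is worth 2, either by taking it or, when the rest has
   negative value, by sacrificing its detached side.  For the player to move
   this gives the value 2b + s + c, where c = 0 if t = p = s = 0, and otherwise
   c = 2p + 1 if t is even, c = 2p - 1 if t is odd and p > 0, and c = -3 if t is
   odd and p = 0.  It is enough to check that no move beats this value and that
   some move attains it. *)

Require Import Defs.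
From mathcomp Require Import all_boot all_order all_algebra.
From mathcomp Require Import zify.

Set Implicit Arguments.
Unset Strict Implicit.
Unset Printing Implicit Defensive.

Import Order.TTheory GRing.Theory Num.Theory.

Local Open Scope ring_scope.

(** * Minimax through a value function *)

Lemma maxseq_eq (s : seq int) (x : int) :
  x \in s -> {in s, forall y, y <= x} -> maxseq s = x.
Proof.
move=> xs sx; apply: le_anti; rewrite [x <= _]le_bigmax_seq // andbT.
rewrite /maxseq big_seq; apply: bigmax_le => //.
by case: s xs sx => // y s _ -> //; rewrite mem_head.
Qed.

Lemma minseq_eq (s : seq int) (x : int) :
  x \in s -> {in s, forall y, x <= y} -> minseq s = x.
Proof.
move=> xs sx; apply: le_anti; rewrite [_ <= x]ge_bigmin_seq //=.
rewrite /minseq big_seq; apply: le_bigmin => //.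
by case: s xs sx => // y s _ -> //; rewrite mem_head.
Qed.

Section Minimax.

Variables (G : multigraph) (V : {set edge G} -> int).

Definition move_value (A : {set edge G}) (e : edge G) : int :=
  let g := gain A e in
  if (0 < g)%N then g%:Z + V (A :\ e) else - V (A :\ e).

Hypothesis V0 : V set0 = 0.
Hypothesis V_ub : forall (A : {set edge G}) e, e \in A -> move_value A e <= V A.
Hypothesis V_att : forall A : {set edge G},
  A != set0 -> exists2 e, e \in A & move_value A e = V A.

(** By induction on the edges left: points already scored only shift the outcome, and negating it
    for Player 2 makes both players maximize [move_value], so the three hypotheses act as Bellman's
    equation for the mover's future margin. *)
Lemma optimal_diffE (p : position G) :
  optimal_diff p = score_diff p +
    (if to_move p is Player1 then V (edges_left p) else - V (edges_left p)).
Proof.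
rewrite /optimal_diff; move Ek: #|edges_left p| => k.
elim: k p Ek => [|k IH] [A X s1 s2] /= cA.
  by rewrite (cards0_eq cA) V0 oppr0; case: X; rewrite addr0.
have outE e : e \in A -> optimal_rec k (remove (Position A X s1 s2) e) =
    (s1%:Z - s2%:Z) + (if X is Player1 then move_value A e else - move_value A e).
  move=> eA; rewrite IH /=; last first.
    by move: cA; rewrite (cardsD1 e) eA => -[].
  by rewrite /score_diff /move_value /=; case: X; case: ifP => /=; lia.
have [|e eA eV] := @V_att A; first by rewrite -card_gt0 cA.
have eO : optimal_rec k (remove (Position A X s1 s2) e) \in
    [seq optimal_rec k (remove (Position A X s1 s2) e) | e <- enum A].
  by apply/mapP; exists e; rewrite ?mem_enum.
case: X outE eO => outE eO.
- rewrite (maxseq_eq eO) ?outE ?eV // => y /mapP[f].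
  by rewrite mem_enum => fA ->; rewrite outE // lerD2l V_ub.
- rewrite (minseq_eq eO) ?outE ?eV // => y /mapP[f].
  by rewrite mem_enum => fA ->; rewrite outE // lerD2l lerN2 V_ub.
Qed.

End Minimax.

(** * Gains as drops in the number of live vertices *)

Lemma isolatedS (G : multigraph) (A B : {set edge G}) (v : vertex G) :
  B \subset A -> isolated A v -> isolated B v.
Proof.
by move=> /subsetP BA /forall_inP Av; apply/forall_inP => e /BA; apply: Av.
Qed.

Definition live (G : multigraph) (A : {set edge G}) : nat :=
  \sum_v ~~ isolated A v.

Lemma gainE (G : multigraph) (A : {set edge G}) (e : edge G) :
  (gain A e + live (A :\ e) = live A)%N.
Proof.
rewrite /gain /live -sum1dep_card big_mkcond -big_split /=.
apply: eq_bigr => v _.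
by have := @isolatedS _ A (A :\ e) v (subsetDl _ _); do 2!case: isolated => //=; move=> /(_ isT).
Qed.

Lemma big_option (T : finType) (F : option T -> nat) :
  (\sum_o F o = F None + \sum_x F (Some x))%N.
Proof.
rewrite (bigD1 None) //=; congr (_ + _)%N.
rewrite (reindex_omap Some id) /=; last by case.
by apply: eq_bigl => x; rewrite eqxx.
Qed.

(** * The game on configurations *)

(* Counts (t, p, s, b) of the intact triangles, of the triangles reduced to one
   spoke and the outer side, of the spokes in triangles that have lost their
   outer side, and of the outer sides cut off from the center. *)
Definition config := (nat * nat * nat * nat)%type.

(** In order, the edge removed is the outer side or a spoke of an intact triangle, the outer side or
    the spoke of a path, a bare spoke, a detached side. *)
Definition move : rel config := fun c d =>
  let: (t, p, s, b) := c in
  let: (t', p', s', b') := d in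
  [|| [&& t == t'.+1, p' == p, s' == s.+2 & b' == b],
      [&& t == t'.+1, p' == p.+1, s' == s & b' == b],
      [&& t' == t, p == p'.+1, s' == s.+1 & b' == b],
      [&& t' == t, p == p'.+1, s' == s & b' == b.+1],
      [&& t' == t, p' == p, s == s'.+1 & b' == b] |
      [&& t' == t, p' == p, s' == s & b == b'.+1]]%N.

Definition value (c : config) : int :=
  let: (t, p, s, b) := c in
  (2 * b + s)%N%:Z +
  if (t + p + s == 0)%N then 0 else
  if ~~ odd t then (2 * p + 1)%N%:Z else
  if (p == 0)%N then -3 else (2 * p)%N%:Z - 1.

(* The number of vertices not yet isolated, the center being the first summand. *)
Definition coins (c : config) : nat :=
  let: (t, p, s, b) := c in
  ((t + p + s != 0) + 2 * t + 2 * p + s + 2 * b)%N.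

Definition move_score (c d : config) : int :=
  if (coins d < coins c)%N then (coins c - coins d)%N%:Z + value d else - value d.

Lemma move_score_le c d : move c d -> move_score c d <= value c.
Proof.
case: c d => [[[t p] s] b] [[[t' p'] s'] b'].
rewrite /move /move_score /value /coins.
case/or4P=> [/and4P[]|/and4P[]|/and4P[]|/or3P[]/and4P[]] => /eqP-> /eqP-> /eqP-> /eqP->;
  by do ?case: ifP; lia.
Qed.

(** Greedy play works, apart from one sacrifice: take a detached side, else a bare spoke, else the
    outer side of a path, else open a triangle. *)
Lemma move_score_att c : (0 < coins c)%N ->
  exists2 d, move c d & move_score c d = value c.
Proof.
case: c => [[[t p] s] b] c0.
case: b c0 => [|b] c0.
  case: s c0 => [|s] c0.
    case: p c0 => [|p] c0.
      case: t c0 => [|t] // _.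
      (* Open by the outer side: with an even number of triangles, cutting a spoke would leave a
         path for the opponent to sacrifice, yielding -1 instead of 1. *)
      by exists (t, 0, 2, 0)%N; rewrite /move_score /value /coins /move; do ?case: ifP; lia.
    (* The sacrifice: with an odd number of triangles and one path, cutting
       the spoke leaves the outer side to the opponent, who must then open a
       triangle. *)
    case: (boolP (odd t && (p == 0)%N)) => tp.
      by exists (t, p, 0, 1)%N; rewrite /move_score /value /coins /move; do ?case: ifP; lia.
    by exists (t, p, 1, 0)%N; rewrite /move_score /value /coins /move; do ?case: ifP; lia.
  by exists (t, p, s, 0)%N; rewrite /move_score /value /coins /move; do ?case: ifP; lia.
by exists (t, p, s, b)%N; rewrite /move_score /value /coins /move; do ?case: ifP; lia.
Qed.

(** * From edge sets to configurations *)

Section Friendship.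

Variable n : nat.
Implicit Types (A : {set edge (friendship n)}) (i : 'I_n).

(** One sum with a parameter [f] serves all four counts, so the effect of a removal is computed only
    once. *)
Definition tally (f : bool -> bool -> bool -> nat) A : nat :=
  \sum_(i < n) f ((i, None) \in A) ((i, Some false) \in A) ((i, Some true) \in A).

Definition triangles := tally (fun c x y => c && x && y).
Definition paths := tally (fun c x y => c && (x (+) y)).
Definition spokes := tally (fun c x y => if c then 0 else x + y)%N.
Definition sides := tally (fun c x y => [&& c, ~~ x & ~~ y]).

Lemma isolated_outer A i (b : bool) :
  @isolated (friendship n) A (Some (i, b)) = ((i, None) \notin A) && ((i, Some b) \notin A).
Proof.
apply/forall_inP/andP => [H|[H1 H2] [j o] jA].
  by split; apply/negP => /H; rewrite /incident /= ?eqxx ?orbT //; case: b {H};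
     rewrite eqxx ?orbT.
apply/negP; rewrite /incident; case: o jA => [c|] jA /=.
  by case/eqP => eij ebc; move: H2; rewrite eij ebc jA.
by case/orP => /eqP[eij _]; move: H1; rewrite eij jA.
Qed.

(** The center is live exactly when a spoke remains, and any spoke lies in an intact triangle, lies
    in a path or is bare. *)
Lemma isolated_center A :
  @isolated (friendship n) A None = (triangles A + paths A + spokes A == 0)%N.
Proof.
rewrite -!big_split sum_nat_eq0 /=.
apply/forall_inP/forallP => [H i|H [j [b|]] jA //].
  have := H (i, Some false); have := H (i, Some true).
  by do 3![case: (_ \in A) => //=]; first [move=> /(_ isT) | move=> _ /(_ isT)].
by apply/negP => _; have := H j; case: b jA => ->; do 2!case: (_ \in A).
Qed.

Lemma liveE A :
  live A = ((triangles A + paths A + spokes A != 0) +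
            2 * triangles A + 2 * paths A + spokes A + 2 * sides A)%N.
Proof.
rewrite /live (@big_option ('I_n * bool)%type) isolated_center -!addnA; congr (_ + _)%N.
have -> : (\sum_(x : 'I_n * bool) ~~ @isolated (friendship n) A (Some x) =
           \sum_(i < n) \sum_b ~~ @isolated (friendship n) A (Some (i, b)))%N.
  by rewrite pair_bigA; apply: eq_bigr => -[].
rewrite !big_distrr -!big_split /=; apply: eq_bigr => i _.
rewrite big_bool !isolated_outer.
by do 3!case: (_ \in A).
Qed.

(** Only the [i]-th summand changes; adding the old and new summands crosswise avoids truncated
    subtraction. *)
Lemma tallyD1 f A i (o : option bool) :
  (tally f (A :\ (i, o)) + f ((i, None) \in A) ((i, Some false) \in A) ((i, Some true) \in A)
  = tally f A + f ((None != o) && ((i, None) \in A))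
                  ((Some false != o) && ((i, Some false) \in A))
                  ((Some true != o) && ((i, Some true) \in A)))%N.
Proof.
rewrite /tally (bigD1 i) // [in RHS](bigD1 i) //= !inE !xpair_eqE eqxx /=.
rewrite (eq_bigr (fun j => f ((j, None) \in A) ((j, Some false) \in A)
                             ((j, Some true) \in A))).
  by rewrite addnAC [RHS]addnAC; congr (_ + _)%N; rewrite addnC.
by move=> j /negPf ji; rewrite !inE !xpair_eqE ji.
Qed.

Lemma tally_gt0 f A : (0 < tally f A)%N -> exists i,
  (0 < f ((i, None) \in A) ((i, Some false) \in A) ((i, Some true) \in A))%N.
Proof.
rewrite lt0n sum_nat_eq0 => /forallPn[i]; rewrite /= -lt0n => fi.
by exists i.
Qed.

Definition config_of A : config := (triangles A, paths A, spokes A, sides A).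

Definition config_tallyD1 A i o :=
  (tallyD1 (fun c x y => c && x && y) A i o,
   tallyD1 (fun c x y => c && (x (+) y)) A i o,
   tallyD1 (fun c x y => if c then 0 else x + y)%N A i o,
   tallyD1 (fun c x y => [&& c, ~~ x & ~~ y]) A i o).

Lemma move_sound A e : e \in A -> move (config_of A) (config_of (A :\ e)).
Proof.
case: e => i o eA; have := config_tallyD1 A i o.
rewrite -/triangles -/paths -/spokes -/sides /move /=.
by case: o eA => [[]|] -> /=; do 2?[case: (_ \in A) => /=];
  case=> [[[Et Ep] Es] Eb]; apply/or4P;
  first [constructor 1; lia | constructor 2; lia | constructor 3; lia
        | constructor 4; apply/or3P;
          first [constructor 1; lia | constructor 2; lia | constructor 3; lia]].
Qed.

Ltac remove_edge A i o E0 E1 E2 :=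
  exists (i, o) => //; have := config_tallyD1 A i o;
  rewrite E0 E1 E2 -/triangles -/paths -/spokes -/sides /config_of /=;
  case=> [[[Et Ep] Es] Eb]; apply/eqP; rewrite !xpair_eqE; lia.

(** Lifts the optimal configuration move to an actual edge; [move_sound] is the converse, used for
    the upper bound. *)
Lemma move_complete A d : move (config_of A) d ->
  exists2 e, e \in A & config_of (A :\ e) = d.
Proof.
case: d => [[[t p] s] b]; rewrite /move.
case/or4P=> [/and4P[]|/and4P[]|/and4P[]|/or3P[]/and4P[]] => dt dp ds db.
- have /tally_gt0[i] : (0 < triangles A)%N by lia.
  case E0: ((i, None) \in A); case E1: ((i, Some false) \in A);
    case E2: ((i, Some true) \in A) => // _.
  by remove_edge A i (@None bool) E0 E1 E2.
- have /tally_gt0[i] : (0 < triangles A)%N by lia.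
  case E0: ((i, None) \in A); case E1: ((i, Some false) \in A);
    case E2: ((i, Some true) \in A) => // _.
  by remove_edge A i (Some true) E0 E1 E2.
- have /tally_gt0[i] : (0 < paths A)%N by lia.
  case E0: ((i, None) \in A); case E1: ((i, Some false) \in A);
    case E2: ((i, Some true) \in A) => // _.
    by remove_edge A i (@None bool) E0 E1 E2.
  by remove_edge A i (@None bool) E0 E1 E2.
- have /tally_gt0[i] : (0 < paths A)%N by lia.
  case E0: ((i, None) \in A); case E1: ((i, Some false) \in A);
    case E2: ((i, Some true) \in A) => // _.
    by remove_edge A i (Some false) E0 E1 E2.
  by remove_edge A i (Some true) E0 E1 E2.
- have /tally_gt0[i] : (0 < spokes A)%N by lia.
  case E0: ((i, None) \in A); case E1: ((i, Some false) \in A);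
    case E2: ((i, Some true) \in A) => // _.
  + by remove_edge A i (Some true) E0 E1 E2.
  + by remove_edge A i (Some false) E0 E1 E2.
  + by remove_edge A i (Some true) E0 E1 E2.
- have /tally_gt0[i] : (0 < sides A)%N by lia.
  case E0: ((i, None) \in A); case E1: ((i, Some false) \in A);
    case E2: ((i, Some true) \in A) => // _.
  by remove_edge A i (@None bool) E0 E1 E2.
Qed.

Lemma coinsE A : coins (config_of A) = live A.
Proof. by rewrite liveE. Qed.

Lemma move_valueE A e :
  move_value (value \o config_of) A e = move_score (config_of A) (config_of (A :\ e)).
Proof.
rewrite /move_value /move_score !coinsE -(gainE A e) addnK.
by rewrite -[in RHS](add0n (live _)) ltn_add2r.
Qed.

Lemma config_of0 : config_of set0 = (0, 0, 0, 0)%N.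
Proof.
by congr (_, _, _, _); apply: big1 => i _; rewrite !inE.
Qed.

Lemma config_ofT : config_of setT = (n, 0, 0, 0)%N.
Proof.
congr (_, _, _, _); rewrite /triangles /paths /spokes /sides /tally.
- by under eq_bigr => i _ do rewrite !inE /=; rewrite sum1_card card_ord.
- by apply: big1 => i _; rewrite !inE.
- by apply: big1 => i _; rewrite !inE.
- by apply: big1 => i _; rewrite !inE.
Qed.

Lemma live_gt0 A : A != set0 -> (0 < live A)%N.
Proof.
case/set0Pn => e eA; rewrite /live (bigD1 (ends e).1) //= addn_gt0 lt0b.
apply/orP; left; apply/negP => /forall_inP/(_ e eA).
by rewrite /incident eqxx.
Qed.

Lemma optimal_diff_start :
  optimal_diff (start (friendship n)) = value (n, 0, 0, 0)%N.
Proof.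
rewrite (@optimal_diffE _ (value \o config_of)).
- by rewrite -config_ofT; apply: add0r.
- by have := congr1 value config_of0.
- by move=> A e eA; rewrite move_valueE move_score_le // move_sound.
- move=> A /live_gt0; rewrite -coinsE => /move_score_att[d].
  by move=> /move_complete[e eA <-] dV; exists e; rewrite ?move_valueE.
Qed.

End Friendship.

Theorem theorem1 (n : nat) (hn : (1 <= n)%N) :
  (odd n -> wins_by (friendship n) Player2 3) /\
  (~~ odd n -> wins_by (friendship n) Player1 1).
Proof.
rewrite /wins_by optimal_diff_start /value.
by split=> on; do ?case: ifP; lia.
Qed.
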